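(* For $0<|q|<1$ (with $q$ a complex number), we have \begin{align*} &\sum_{n=0}^{\infty}\frac{(q;q^2)_n(-q)^n}{(-q;q^2)_{n}(1+q^{2n})}\,p_{2n}(-1;q^{-2n-1},-1:q)\\ &=\frac{1}{2} \frac{(q;q^2)_{\infty}}{(-q;q^2)_{\infty}}+\frac{4q^2}{1+q}\sum_{n=0}^{\infty}\frac{(q^3;q^2)_n(-q)^n}{(-q^3;q^2)_{n}(1+q^{2n+2})}\sum_{j=0}^{n}\frac{(-q;q)_{2j}\,q^{2j}}{(q^2;q)_{2j}}. \end{align*}
   Context: Notation: $(A;q)_0=1$, $(A;q)_n=(1-A)(1-Aq)\cdots(1-Aq^{n-1})$ for $n\ge 1$, and $(A;q)_\infty=\lim_{n\to\infty}(A;q)_n$ for $|q|<1$. The basic hypergeometric series is ${}_{2}\phi_{1}\!\left(\begin{matrix}a_1,a_2\\ b_1\end{matrix};q,z\right)=\sum_{j\ge0}\frac{(a_1;q)_j(a_2;q)_j}{(q;q)_j(b_1;q)_j}z^j$. The little $q$-Jacobi polynomials are $p_n(x;\alpha,\beta:q)={}_{2}\phi_{1}\!\left(\begin{matrix}q^{-n},\ \alpha\beta q^{n+1}\\ \alpha q\end{matrix};q,qx\right)$, understood as the terminating sum over $0\le j\le n$. In particular, with $\alpha=q^{-2n-1}$, $\beta=-1$, $x=-1$ (after cancelling the factor $(q^{-2n};q)_j$ common to numerator and denominator), $p_{2n}(-1;q^{-2n-1},-1:q)=\sum_{j=0}^{2n}\frac{(-1;q)_j}{(q;q)_j}(-q)^j$.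 *)

(* Defs.v *)
From Stdlib Require Export Reals.
From Coquelicot Require Export Coquelicot.

Open Scope C_scope.

(** Coquelicot's total operators [Lim_seq] and [Series] are real-valued; here
    they are applied to the real and imaginary parts.  As with those operators,
    the values are meaningful only when the limit exists
    (see [Clim_seq_unique] and [CSeries_unique]). *)
Definition Clim_seq (u : nat -> C) : C :=
  (real (Lim_seq (fun n => Re (u n))), real (Lim_seq (fun n => Im (u n)))).

Definition CSeries (a : nat -> C) : C :=
  (Series (fun n => Re (a n)), Series (fun n => Im (a n))).

Lemma Clim_seq_unique (u : nat -> C) (l : C) :
  filterlim u eventually (locally l) -> Clim_seq u = l.
Proof.
intros H; unfold Clim_seq; destruct l as [x y].
f_equal.
- assert (E : is_lim_seq (fun n => Re (u n)) x).
  { intros P HP. apply (H (fun z => P (fst z))).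
    destruct HP as [e He]; exists e; intros z [Hz _]; exact (He _ Hz). }
  now rewrite (is_lim_seq_unique _ _ E).
- assert (E : is_lim_seq (fun n => Im (u n)) y).
  { intros P HP. apply (H (fun z => P (snd z))).
    destruct HP as [e He]; exists e; intros z [_ Hz]; exact (He _ Hz). }
  now rewrite (is_lim_seq_unique _ _ E).
Qed.

Lemma CSeries_unique (a : nat -> C) (l : C) :
  is_series a l -> CSeries a = l.
Proof.
intros H; rewrite <- (Clim_seq_unique (sum_n a) l H).
unfold CSeries, Clim_seq, Series; f_equal; f_equal; apply Lim_seq_ext;
  intros n; induction n as [|n IH]; rewrite ?sum_O, ?sum_Sn; try easy;
  rewrite IH; reflexivity.
Qed.

(** [(A;q)_n] *)
Fixpoint qpoch (A q : C) (n : nat) : C :=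
  match n with
  | O => 1
  | S m => qpoch A q m * (1 - A * q ^ m)
  end.

(** [(A;q)_oo], for [Cmod q < 1] *)
Definition qpoch_inf (A q : C) : C := Clim_seq (qpoch A q).

(** The [j]-th term of the series [2phi1(a1, a2; b1; q, z)] *)
Definition phi21_term (a1 a2 b1 q z : C) (j : nat) : C :=
  (qpoch a1 q j * qpoch a2 q j) / (qpoch q q j * qpoch b1 q j) * z ^ j.

(** [p_n(x; alpha, beta : q)].  The series is cut off at [j = n], where it
    terminates because of the parameter [q^(-n)]: when [alpha * q = q^(-m)] with
    [m >= n], the terms beyond [j = m] are of the form 0/0. *)
Definition little_q_jacobi (n : nat) (x alpha beta q : C) : C :=
  sum_n (phi21_term (/ q ^ n) (alpha * beta * q ^ (n + 1)) (alpha * q)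
                    q (q * x)) n.

(* Main.v *)
(** Write [a_j = (-1;q)_j (-q)^j / (q;q)_j], so that the polynomial on the left
    is [P_n = a_0 + ... + a_(2n)], and let [c_n] be its coefficient.  Up to
    constant factors, the [n]-th term on the right is [c_(n+1) O_n] with
    [O_n = a_1 + a_3 + ... + a_(2n+1)], and the right-hand series is
    [2 sum_n c_(n+1) O_n].  Now [P_(n+1) - 2 O_n] is the alternating sum
    [sum_(j <= 2n+2) (-1;q)_j q^j / (q;q)_j], which telescopes to
    [(-q;q)_(2n+2) / (q;q)_(2n+2)].  Hence the two series differ by
    [sum_n c_n (-q;q)_(2n) / (q;q)_(2n)
     = 1/2 sum_n (-1;q^2)_n (-q)^n / (q^2;q^2)_n], which the q-binomial theorem
    in base [q^2] evaluates. *)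

Require Import Defs.
From Stdlib Require Import Reals Lra Lia.
From Coquelicot Require Import Coquelicot.
Open Scope C_scope.

(** * Limits of complex sequences *)

(* [filterlim_mult] on [C_AbsRing] is about the uniform structure induced by
   [Cmod], while [is_series] on [C_NormedModule] uses the product structure of
   [R * R]; stating limits through [Cmod] avoids mixing the two. *)
Definition Clim (u : nat -> C) (l : C) : Prop :=
  is_lim_seq (fun n => Cmod (u n - l)) 0%R.

(** Gives access to [is_series] and [Clim_seq_unique], which are stated with filters: the norm balls
    of [C_NormedModule] are the discs of [Cmod]. *)
Lemma Clim_filterlim (u : nat -> C) (l : C) :
  Clim u l <-> filterlim u eventually (locally l).
Proof.
unfold Clim; split.
- intros H.
  apply (proj2 (filterlim_locally_ball_norm (K := C_AbsRing) (U := C_NormedModule) u l)).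
  intros eps; apply is_lim_seq_spec in H.
  destruct (H eps) as [N HN]; exists N; intros n Hn.
  specialize (HN n Hn); rewrite Rminus_0_r, Rabs_pos_eq in HN by apply Cmod_ge_0.
  exact HN.
- intros H; apply is_lim_seq_spec; intros eps.
  destruct (proj1 (filterlim_locally_ball_norm (K := C_AbsRing) (U := C_NormedModule) u l) H eps)
    as [N HN]; exists N; intros n Hn.
  rewrite Rminus_0_r, Rabs_pos_eq by apply Cmod_ge_0.
  exact (HN n Hn).
Qed.

Lemma Clim_ext (u v : nat -> C) (l : C) :
  (forall n, u n = v n) -> Clim u l -> Clim v l.
Proof.
intros E; apply is_lim_seq_ext; intros n; now rewrite E.
Qed.

Lemma Clim_const (c : C) : Clim (fun _ => c) c.
Proof.
apply is_lim_seq_ext with (fun _ => 0%R); [|apply is_lim_seq_const].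
intros _; replace (c - c) with (RtoC 0) by ring; now rewrite Cmod_0.
Qed.

Lemma Clim_dominated (u : nat -> C) (l : C) (b : nat -> R) :
  (forall n, Cmod (u n - l) <= b n)%R -> is_lim_seq b 0%R -> Clim u l.
Proof.
intros H Hb; apply is_lim_seq_le_le with (fun _ => 0%R) b; auto.
- intros n; split; [apply Cmod_ge_0 | apply H].
- apply is_lim_seq_const.
Qed.

Lemma Clim_Cmod (u : nat -> C) (l : C) :
  Clim u l -> is_lim_seq (fun n => Cmod (u n)) (Cmod l).
Proof.
intros H.
apply is_lim_seq_le_le
  with (fun n => Cmod l - Cmod (u n - l))%R (fun n => Cmod l + Cmod (u n - l))%R.
- intros n; split.
  + generalize (Cmod_triangle (u n) (- (u n - l))).
    rewrite Cmod_opp; replace (u n + - (u n - l)) with l by ring; lra.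
  + generalize (Cmod_triangle l (u n - l)).
    replace (l + (u n - l)) with (u n) by ring; lra.
- replace (Finite (Cmod l)) with (Finite (Cmod l - 0)) by (f_equal; ring).
  apply is_lim_seq_minus'; [apply is_lim_seq_const | exact H].
- replace (Finite (Cmod l)) with (Finite (Cmod l + 0)) by (f_equal; ring).
  apply is_lim_seq_plus'; [apply is_lim_seq_const | exact H].
Qed.

Lemma Clim_plus (u v : nat -> C) (l m : C) :
  Clim u l -> Clim v m -> Clim (fun n => u n + v n) (l + m).
Proof.
intros Hu Hv.
apply Clim_dominated with (fun n => Cmod (u n - l) + Cmod (v n - m))%R.
- intros n; replace (u n + v n - (l + m)) with ((u n - l) + (v n - m)) by ring.
  apply Cmod_triangle.
- replace (Finite 0) with (Finite (0 + 0)) by (f_equal; ring).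
  now apply is_lim_seq_plus'.
Qed.

Lemma Clim_mult (u v : nat -> C) (l m : C) :
  Clim u l -> Clim v m -> Clim (fun n => u n * v n) (l * m).
Proof.
intros Hu Hv.
apply Clim_dominated
  with (fun n => Cmod (u n) * Cmod (v n - m) + Cmod (u n - l) * Cmod m)%R.
- intros n; replace (u n * v n - l * m) with (u n * (v n - m) + (u n - l) * m) by ring.
  rewrite <- !Cmod_mult; apply Cmod_triangle.
- replace (Finite 0) with (Finite (Cmod l * 0 + 0 * Cmod m)) by (f_equal; ring).
  apply is_lim_seq_plus'; apply is_lim_seq_mult'; auto using is_lim_seq_const, Clim_Cmod.
Qed.

Lemma Clim_inv (u : nat -> C) (l : C) :
  (forall n, u n <> 0) -> l <> 0 -> Clim u l -> Clim (fun n => / u n) (/ l).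
Proof.
intros Hn Hl Hu; unfold Clim.
assert (Hl' : Cmod l <> 0%R) by (intros E; now apply Hl, Cmod_eq_0).
apply is_lim_seq_ext with (fun n => Cmod (u n - l) / (Cmod (u n) * Cmod l))%R.
- intros n; rewrite <- Cmod_mult.
  rewrite <- Cmod_div by now apply Cmult_neq_0.
  rewrite <- Cmod_opp; f_equal; now field.
- replace (Finite 0) with (Finite (0 / (Cmod l * Cmod l))) by (f_equal; now field).
  apply is_lim_seq_div'.
  + exact Hu.
  + apply is_lim_seq_mult'; [now apply Clim_Cmod | apply is_lim_seq_const].
  + now apply Rmult_integral_contrapositive_currified.
Qed.

Lemma Clim_unique (u : nat -> C) (l m : C) : Clim u l -> Clim u m -> l = m.
Proof.
intros H1 H2; apply Clim_filterlim, Clim_seq_unique in H1.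
apply Clim_filterlim, Clim_seq_unique in H2; congruence.
Qed.

Lemma Clim_pow (p : C) : (Cmod p < 1)%R -> Clim (fun n => p ^ n) 0.
Proof.
intros Hp; apply Clim_dominated with (fun n => Cmod p ^ n)%R.
- intros n; replace (p ^ n - 0) with (p ^ n) by ring; rewrite Cmod_pow; lra.
- apply is_lim_seq_geom; rewrite Rabs_pos_eq; auto using Cmod_ge_0.
Qed.

Lemma Clim_bounded (u : nat -> C) (l : C) :
  Clim u l -> exists M, forall n, (Cmod (u n) <= M)%R.
Proof.
intros H.
destruct (filterlim_bounded (K := C_AbsRing) (V := C_NormedModule) u) as [M HM].
- exists l; now apply Clim_filterlim.
- exists M; exact HM.
Qed.

(** * Absolute convergence and the ratio test *)

Lemma ex_series_Cmod (a : nat -> C) :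
  ex_series (fun n => Cmod (a n)) -> ex_series a.
Proof.
apply (ex_series_le (K := C_AbsRing) (V := C_CompleteNormedModule)).
intros n; apply Rle_refl.
Qed.

Lemma Cmod_series_le (a : nat -> C) (b : nat -> R) (l : C) (B : R) :
  (forall n, Cmod (a n) <= b n)%R -> is_series a l -> is_series b B ->
  (Cmod l <= B)%R.
Proof.
intros H Ha Hb.
apply is_lim_seq_le with (u := fun n => Cmod (sum_n a n)) (v := sum_n b)
  (l1 := Finite (Cmod l)) (l2 := Finite B); [|now apply Clim_Cmod, Clim_filterlim|exact Hb].
induction n as [|n IH]; rewrite ?sum_O, ?sum_Sn; [apply H|].
apply Rle_trans with (1 := Cmod_triangle _ _), Rplus_le_compat; auto.
Qed.

(** From the rank [N] on, the terms are dominated by the geometric sequence [b N * r ^ n]. *)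
Lemma ex_series_ratio (b : nat -> R) (r : R) :
  (forall n, 0 <= b n)%R -> (0 <= r < 1)%R ->
  eventually (fun n => b (S n) <= r * b n)%R -> ex_series b.
Proof.
intros Hb Hr [N HN].
apply (ex_series_incr_n (V := R_NormedModule) b N).
apply (ex_series_le (K := R_AbsRing) (V := R_CompleteNormedModule))
  with (fun n => b N * r ^ n)%R.
- intros n; change (Rabs (b (N + n)%nat) <= b N * r ^ n)%R.
  rewrite Rabs_pos_eq by auto.
  induction n as [|n IH]; [rewrite Nat.add_0_r; simpl; lra|].
  rewrite Nat.add_succ_r; apply Rle_trans with (1 := HN (N + n)%nat ltac:(lia)).
  simpl; apply Rle_trans with (r * (b N * r ^ n))%R; [|lra].
  apply Rmult_le_compat_l; lra.
- apply (ex_series_scal (V := R_NormedModule)), ex_series_geom.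
  rewrite Rabs_pos_eq; lra.
Qed.

(** * Finite q-Pochhammer symbols *)

Lemma one_sub_pow_neq_0 (A p : C) (n : nat) :
  (Cmod A < 1)%R -> (Cmod p <= 1)%R -> 1 - A * p ^ n <> 0.
Proof.
intros HA Hp E.
assert (E' : A * p ^ n = 1) by (replace (A * p ^ n) with (1 - (1 - A * p ^ n)) by ring; rewrite E; ring).
apply (f_equal Cmod) in E'; rewrite Cmod_mult, Cmod_pow, Cmod_1 in E'.
assert (Cmod p ^ n <= 1)%R.
{ rewrite <- (pow1 n); apply pow_incr; split; auto using Cmod_ge_0. }
assert (0 <= Cmod p ^ n)%R by (apply pow_le, Cmod_ge_0).
generalize (Cmod_ge_0 A); nra.
Qed.

Lemma one_sub_neq_0 (A : C) : (Cmod A < 1)%R -> 1 - A <> 0.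
Proof.
intros HA; rewrite <- (Cmult_1_r A).
apply (one_sub_pow_neq_0 A 0 0); rewrite ?Cmod_0; lra.
Qed.

Lemma qpoch_neq_0 (A p : C) (n : nat) :
  (Cmod A < 1)%R -> (Cmod p <= 1)%R -> qpoch A p n <> 0.
Proof.
intros HA Hp; induction n as [|n IH]; simpl; [apply C1_nz|].
apply Cmult_neq_0; auto using one_sub_pow_neq_0.
Qed.

Lemma qpoch_0_l (p : C) (n : nat) : qpoch 0 p n = 1.
Proof. induction n as [|n IH]; simpl; [easy|]; rewrite IH; ring. Qed.

Lemma qpoch_S_l (A p : C) (n : nat) :
  qpoch A p (S n) = (1 - A) * qpoch (A * p) p n.
Proof.
induction n as [|n IH]; [simpl; ring|].
change (qpoch A p (S (S n))) with (qpoch A p (S n) * (1 - A * p ^ S n)).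
rewrite IH; simpl; rewrite ?Cpow_S; ring.
Qed.

(** The factors [1 - A * p ^ k] are sorted by the parity of [k]. *)
Lemma qpoch_double (A p : C) (n : nat) :
  qpoch A p (2 * n) = qpoch A (p ^ 2) n * qpoch (A * p) (p ^ 2) n.
Proof.
induction n as [|n IH]; [simpl; ring|].
replace (2 * S n)%nat with (S (S (2 * n))) by lia.
cbn [qpoch]; rewrite IH, <- Cpow_mult_r, !Cpow_S; ring.
Qed.

(** * The q-binomial series 1phi0(a; -; p, z) and its product formula *)

Definition qbinom_term (a p z : C) (n : nat) : C :=
  qpoch a p n / qpoch p p n * z ^ n.

Definition qbinom_sum (a p z : C) : C := CSeries (qbinom_term a p z).

Section QBinomial.
Variable p : C.
Hypothesis Hp : (Cmod p < 1)%R.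

Lemma qbinom_term_S (a z : C) (n : nat) :
  qbinom_term a p z (S n)
  = (1 - a * p ^ n) * / (1 - p * p ^ n) * z * qbinom_term a p z n.
Proof.
unfold qbinom_term; cbn [qpoch]; rewrite Cpow_S; field; split.
- apply qpoch_neq_0; lra.
- apply one_sub_pow_neq_0; lra.
Qed.

(** The ratio of consecutive terms tends to [z], so its modulus is eventually below the midpoint of
    [Cmod z] and 1. *)
Lemma qbinom_ex_series_Cmod (a z : C) :
  (Cmod z < 1)%R -> ex_series (fun n => Cmod (qbinom_term a p z n)).
Proof.
intros Hz.
assert (HL : Clim (fun n => (1 - a * p ^ n) * / (1 - p * p ^ n) * z) z).
{ assert (E : (1 + - a * 0) * / (1 + - p * 0) * z = z).
  { field; intros E; apply C1_nz; rewrite <- E; ring. }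
  refine (eq_ind _ (Clim _) _ _ E).
  assert (HA : forall A, Clim (fun n => 1 - A * p ^ n) (1 + - A * 0)).
  { intros A; apply Clim_ext with (fun n => 1 + - A * p ^ n); [intros n; ring|].
    apply Clim_plus; [apply Clim_const|].
    apply Clim_mult; [apply Clim_const | now apply Clim_pow]. }
  apply Clim_mult; [apply Clim_mult; [apply HA|] | apply Clim_const].
  apply Clim_inv; [| |apply HA].
  - intros n; apply one_sub_pow_neq_0; lra.
  - replace (1 + - p * 0) with (RtoC 1) by ring; apply C1_nz. }
apply Clim_Cmod, is_lim_seq_spec in HL.
assert (He : (0 < (1 - Cmod z) / 2)%R) by lra.
apply ex_series_ratio with ((1 + Cmod z) / 2)%R.
- intros n; apply Cmod_ge_0.
- generalize (Cmod_ge_0 z); lra.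
- destruct (HL (mkposreal _ He)) as [N HN]; exists N; intros n Hn.
  rewrite qbinom_term_S, Cmod_mult.
  apply Rmult_le_compat_r; [apply Cmod_ge_0|].
  specialize (HN n Hn); simpl in HN; apply Rabs_lt_between in HN; lra.
Qed.

Lemma qbinom_sum_correct (a z : C) :
  (Cmod z < 1)%R -> is_series (qbinom_term a p z) (qbinom_sum a p z).
Proof.
intros Hz.
destruct (ex_series_Cmod _ (qbinom_ex_series_Cmod a z Hz)) as [l Hl].
unfold qbinom_sum; now rewrite (CSeries_unique _ _ Hl).
Qed.

Lemma Cmod_mult_pow_lt_1 (z : C) (n : nat) :
  (Cmod z < 1)%R -> (Cmod (z * p ^ n) < 1)%R.
Proof.
intros Hz; rewrite Cmod_mult, Cmod_pow.
assert (Cmod p ^ n <= 1)%R.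
{ rewrite <- (pow1 n); apply pow_incr; split; [apply Cmod_ge_0 | lra]. }
assert (0 <= Cmod p ^ n)%R by (apply pow_le, Cmod_ge_0).
generalize (Cmod_ge_0 z); nra.
Qed.

(** Write F(z) for the sum. The [n]-th term of F(z) - F(zp) carries the factor [1 - p ^ n], which
    cancels the last factor of [qpoch p p n]. What remains is [z * (1 - a * p ^ (n - 1))] times the
    preceding term, whence F(z) - F(zp) = z (F(z) - a F(zp)). *)
Lemma qbinom_sum_shift (a z : C) :
  (Cmod z < 1)%R ->
  (1 - z) * qbinom_sum a p z = (1 - a * z) * qbinom_sum a p (z * p).
Proof.
intros Hz.
assert (Hzp : (Cmod (z * p) < 1)%R).
{ rewrite <- (Cpow_1_r p); now apply Cmod_mult_pow_lt_1. }
set (F := qbinom_sum a p z); set (G := qbinom_sum a p (z * p)).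
assert (HF : is_series (qbinom_term a p z) F) by now apply qbinom_sum_correct.
assert (HG : is_series (qbinom_term a p (z * p)) G) by now apply qbinom_sum_correct.
assert (H1 : is_series (fun n => qbinom_term a p z n - qbinom_term a p (z * p) n) (F - G)).
{ exact (is_series_minus _ _ _ _ HF HG). }
assert (H2 : is_series (fun n => z * (qbinom_term a p z n - a * qbinom_term a p (z * p) n))
               (z * (F - a * G))).
{ exact (is_series_scal z _ _ (is_series_minus _ _ _ _ HF (is_series_scal a _ _ HG))). }
assert (E : F - G = z * (F - a * G)).
{ apply CSeries_unique in H2; rewrite <- H2; symmetry; apply CSeries_unique.
  apply is_series_ext with
    (fun n => qbinom_term a p z (S n) - qbinom_term a p (z * p) (S n)).
  - intros n; rewrite !qbinom_term_S.
    assert (E : qbinom_term a p (z * p) n = p ^ n * qbinom_term a p z n).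
    { unfold qbinom_term; rewrite Cpow_mult_l; ring. }
    rewrite E; match goal with |- ?x = ?y => change (@eq C x y) end.
    field; apply one_sub_pow_neq_0; lra.
  (* The index shift costs nothing, since the difference vanishes at [n = 0]. *)
  - apply (is_series_incr_1 (fun n => qbinom_term a p z n - qbinom_term a p (z * p) n)).
    refine (eq_ind _ (is_series _) H1 _ _).
    change (F - G = F - G + (qbinom_term a p z 0 - qbinom_term a p (z * p) 0)).
    unfold qbinom_term; simpl; ring. }
replace ((1 - z) * F) with (F - G + G - z * F) by ring.
rewrite E; ring.
Qed.

Lemma qbinom_sum_iter (a z : C) (n : nat) :
  (Cmod z < 1)%R ->
  qpoch z p n * qbinom_sum a p z
  = qpoch (a * z) p n * qbinom_sum a p (z * p ^ n).
Proof.
intros Hz; induction n as [|n IH]; [simpl; now rewrite !Cmult_1_l, Cmult_1_r|].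
cbn [qpoch].
replace (qpoch z p n * (1 - z * p ^ n) * qbinom_sum a p z)
  with ((1 - z * p ^ n) * (qpoch z p n * qbinom_sum a p z)) by ring.
rewrite IH.
replace ((1 - z * p ^ n) * (qpoch (a * z) p n * qbinom_sum a p (z * p ^ n)))
  with (qpoch (a * z) p n * ((1 - z * p ^ n) * qbinom_sum a p (z * p ^ n))) by ring.
rewrite qbinom_sum_shift by now apply Cmod_mult_pow_lt_1.
replace (z * p ^ n * p) with (z * p ^ S n) by (rewrite Cpow_S; ring).
ring.
Qed.

(** Apart from the constant term 1, each term at [z * p ^ n] is the term at [z] times a positive
    power of [p ^ n]. Hence the distance to 1 is at most [Cmod p ^ n] times the sum of the moduli of
    the nonconstant terms at [z]. *)
Lemma qbinom_sum_lim (a z : C) :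
  (Cmod z < 1)%R -> Clim (fun n => qbinom_sum a p (z * p ^ n)) 1.
Proof.
intros Hz.
assert (HE : exists B : R, is_series (fun n => Cmod (qbinom_term a p z n)) B)
  by exact (qbinom_ex_series_Cmod a z Hz).
destruct HE as [B HB].
assert (HB' : is_series (fun k => Cmod (qbinom_term a p z (S k)))
                (B - Cmod (qbinom_term a p z 0))%R).
{ apply (is_series_incr_1 (fun k => Cmod (qbinom_term a p z k))).
  refine (eq_ind _ (is_series _) HB _ _).
  change (@eq R B (B - Cmod (qbinom_term a p z 0) + Cmod (qbinom_term a p z 0))%R).
  ring. }
set (M := (B - Cmod (qbinom_term a p z 0))%R) in *.
apply Clim_dominated with (fun n => Cmod p ^ n * M)%R.
- intros n.
  apply Cmod_series_le with (fun k => qbinom_term a p (z * p ^ n) (S k))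
    (fun k => Cmod p ^ n * Cmod (qbinom_term a p z (S k)))%R.
  + intros k; unfold qbinom_term.
    rewrite Cpow_mult_l, (Cpow_S (p ^ n)), !Cmod_mult, (Cmod_pow p n).
    assert (H1 : (Cmod ((p ^ n) ^ k) <= 1)%R).
    { rewrite !Cmod_pow, <- pow_mult, <- (pow1 (n * k)); apply pow_incr.
      split; [apply Cmod_ge_0 | lra]. }
    set (X := Cmod (qpoch a p (S k) / qpoch p p (S k))).
    assert (0 <= X * Cmod (z ^ S k) * Cmod p ^ n)%R.
    { repeat apply Rmult_le_pos; try apply Cmod_ge_0; apply pow_le, Cmod_ge_0. }
    generalize (Rmult_le_compat_l _ _ _ H H1); lra.
  + apply (is_series_incr_1 (qbinom_term a p (z * p ^ n))).
    refine (eq_ind (qbinom_sum a p (z * p ^ n)) (is_series _) _ _ _).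
    * now apply qbinom_sum_correct, Cmod_mult_pow_lt_1.
    * change (qbinom_sum a p (z * p ^ n)
        = qbinom_sum a p (z * p ^ n) - 1 + 1 / 1 * 1).
      field; apply C1_nz.
  + exact (is_series_scal (K := R_AbsRing) (V := R_NormedModule) _ _ _ HB').
- replace (Finite 0) with (Finite (0 * M)) by (f_equal; ring).
  apply is_lim_seq_mult'; [|apply is_lim_seq_const].
  apply is_lim_seq_geom; rewrite Rabs_pos_eq; auto using Cmod_ge_0.
Qed.

(* Taking [a = 0], the product [(z;p)_n] equals [F(z p^n) / F(z)], where [F] is
   the sum of the series and [F(z p^n)] tends to [1]. *)
Lemma qpoch_lim (z : C) :
  (Cmod z < 1)%R -> Clim (qpoch z p) (qpoch_inf z p) /\ qpoch_inf z p <> 0.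
Proof.
intros Hz.
assert (E : forall n, qbinom_sum 0 p (z * p ^ n) = qpoch z p n * qbinom_sum 0 p z).
{ intros n; rewrite qbinom_sum_iter, Cmult_0_l, qpoch_0_l by easy; ring. }
assert (HL := qbinom_sum_lim 0 z Hz).
(* Otherwise [E] would make a sequence with limit 1 identically zero. *)
assert (H0 : qbinom_sum 0 p z <> 0).
{ intros E0; apply C1_nz, (Clim_unique _ _ _ HL).
  apply Clim_ext with (fun _ => RtoC 0); [|apply Clim_const].
  intros n; rewrite E, E0; ring. }
assert (H : Clim (qpoch z p) (1 * / qbinom_sum 0 p z)).
{ apply Clim_ext with (fun n => qbinom_sum 0 p (z * p ^ n) * / qbinom_sum 0 p z).
  - intros n; rewrite E; now field.
  - apply Clim_mult; [exact HL | apply Clim_const]. }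
unfold qpoch_inf; rewrite (Clim_seq_unique _ _ (proj1 (Clim_filterlim _ _) H)).
split; [exact H|].
intros E0; apply C1_nz.
transitivity (1 * / qbinom_sum 0 p z * qbinom_sum 0 p z); [now field|].
rewrite E0; ring.
Qed.

(** Let [n] tend to infinity in [qbinom_sum_iter]; the sum on its right tends to 1. *)
Theorem q_binomial (a z : C) :
  (Cmod z < 1)%R -> (Cmod (a * z) < 1)%R ->
  is_series (qbinom_term a p z) (qpoch_inf (a * z) p / qpoch_inf z p).
Proof.
intros Hz Haz.
destruct (qpoch_lim z Hz) as [Lz Nz], (qpoch_lim (a * z) Haz) as [La _].
replace (qpoch_inf (a * z) p / qpoch_inf z p) with (qbinom_sum a p z);
  [now apply qbinom_sum_correct|].
assert (E : qpoch_inf z p * qbinom_sum a p z = qpoch_inf (a * z) p * 1).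
{ apply Clim_unique with (fun n => qpoch z p n * qbinom_sum a p z).
  - apply Clim_mult; [exact Lz | apply Clim_const].
  - apply Clim_ext with (fun n => qpoch (a * z) p n * qbinom_sum a p (z * p ^ n)).
    + intros n; now rewrite qbinom_sum_iter.
    + apply Clim_mult; [exact La | now apply qbinom_sum_lim]. }
rewrite Cmult_1_r in E; rewrite <- E; now field.
Qed.

(** At argument [p] the partial sums telescope, because (1 - p^(n+1)) + (1 - a) p^(n+1) = 1 - a
    p^(n+1). With [a = - 1] this evaluates the alternating sum. *)
Lemma sum_qbinom_term (a : C) (n : nat) :
  sum_n (qbinom_term a p p) n = qpoch (a * p) p n / qpoch p p n.
Proof.
assert (N : forall n, qpoch p p n <> 0) by (intros; apply qpoch_neq_0; lra).
induction n as [|n IH]; [rewrite sum_O; unfold qbinom_term; simpl; now rewrite Cmult_1_r|].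
rewrite sum_Sn, IH; unfold qbinom_term; rewrite (qpoch_S_l a); cbn [qpoch].
change (qpoch (a * p) p n / qpoch p p n
  + (1 - a) * qpoch (a * p) p n / (qpoch p p n * (1 - p * p ^ n)) * p ^ S n
  = qpoch (a * p) p n * (1 - a * p * p ^ n) / (qpoch p p n * (1 - p * p ^ n))).
rewrite Cpow_S; field; split; auto.
apply one_sub_pow_neq_0; lra.
Qed.

End QBinomial.

(** * Parity splitting and the little q-Jacobi polynomial as a partial sum *)

Lemma ex_series_bounded_mul_pow (u : nat -> C) (l z : C) :
  Clim u l -> (Cmod z < 1)%R -> ex_series (fun n => u n * z ^ n).
Proof.
intros Hu Hz; destruct (Clim_bounded _ _ Hu) as [M HM].
apply ex_series_Cmod.
apply (ex_series_le (K := R_AbsRing) (V := R_CompleteNormedModule))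
  with (fun n => M * Cmod z ^ n)%R.
- intros n; change (Rabs (Cmod (u n * z ^ n)) <= M * Cmod z ^ n)%R.
  rewrite Rabs_pos_eq, Cmod_mult, Cmod_pow by apply Cmod_ge_0.
  apply Rmult_le_compat_r; [apply pow_le, Cmod_ge_0 | apply HM].
- apply (ex_series_scal (V := R_NormedModule)), ex_series_geom.
  rewrite Rabs_pos_eq; auto using Cmod_ge_0.
Qed.

(** Subtracting [(- (1)) ^ j * a j] from [a j] kills the even indices and doubles the odd ones,
    which run here from 1 to [2 * n + 1]. *)
Lemma sum_n_even_odd (a : nat -> C) (n : nat) :
  sum_n a (2 * S n) = 2 * sum_n (fun j => a (2 * j + 1)%nat) n
    + sum_n (fun j => (- (1)) ^ j * a j) (2 * S n).
Proof.
induction n as [|n IH].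
- change (2 * 1)%nat with 2%nat; rewrite !sum_Sn, !sum_O.
  change (a 0%nat + a 1%nat + a 2%nat
    = 2 * a 1%nat + ((- (1)) ^ 0 * a 0%nat + (- (1)) ^ 1 * a 1%nat + (- (1)) ^ 2 * a 2%nat)).
  ring.
- replace (2 * S (S n))%nat with (S (S (2 * S n))) by lia.
  rewrite !(sum_Sn _ (S (2 * S n))), !(sum_Sn _ (2 * S n)), (sum_Sn _ n), IH.
  replace (2 * S n + 1)%nat with (S (2 * S n)) by lia.
  assert (E : (- (1)) ^ (2 * S n) = 1).
  { rewrite Cpow_mult_r; replace ((- (1)) ^ 2) with (RtoC 1) by ring; apply Cpow_1_l. }
  rewrite !(Cpow_S (- (1))), E.
  set (x := a (S (2 * S n))); set (y := a (S (S (2 * S n)))).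
  unfold plus; simpl; ring.
Qed.

(** Here [alpha * q] equals the first upper parameter [/ q ^ (2 * n)], so the two Pochhammer symbols
    cancel, and the second upper parameter is -1. *)
Lemma little_q_jacobi_as_qbinom (q : C) (n : nat) :
  q <> 0 -> (Cmod q < 1)%R ->
  little_q_jacobi (2 * n) (- (1)) (/ q ^ (2 * n + 1)) (- (1)) q
  = sum_n (qbinom_term (- (1)) q (- q)) (2 * n).
Proof.
intros Hq0 Hq; unfold little_q_jacobi.
apply sum_n_ext_loc; intros j Hj; unfold phi21_term, qbinom_term.
assert (Hp : forall k, q ^ k <> 0) by (intros; now apply Cpow_nz).
replace (/ q ^ (2 * n + 1) * - (1) * q ^ (2 * n + 1)) with (- (1)) by (now field).
replace (/ q ^ (2 * n + 1) * q) with (/ q ^ (2 * n))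
  by (rewrite Cpow_add_r, Cpow_1_r; now field).
replace (q * - (1)) with (- q) by ring.
match goal with |- ?x = ?y => change (@eq C x y) end.
field; split; [apply qpoch_neq_0; lra|].
(* The cancelled symbol is nonzero only because [j <= 2 * n]: each of its factors has the form 1 -
   q^(-(m+1)), a nonzero multiple of 1 - q^(m+1). *)
induction j as [|j IH]; [apply C1_nz|].
apply Cmult_neq_0; [apply IH; lia|].
assert (Em : (2 * n = 2 * n - j - 1 + 1 + j)%nat) by lia.
set (m := (2 * n - j - 1)%nat) in Em; rewrite Em, !Cpow_add_r, Cpow_1_r.
intros E; apply (one_sub_pow_neq_0 q q m Hq (Rlt_le _ _ Hq)).
transitivity (- (q ^ m * q) * (1 - / (q ^ m * q * q ^ j) * q ^ j)).
- field; auto.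
- rewrite E; ring.
Qed.

Lemma Clim_even_subseq (u : nat -> C) (l : C) :
  Clim u l -> Clim (fun n => u (2 * n)%nat) l.
Proof.
intros H; apply (is_lim_seq_subseq (fun n => Cmod (u n - l)) _ (fun n => (2 * n)%nat)); [|exact H].
apply eventually_subseq; intros n; lia.
Qed.

Lemma one_add_pow_neq_0 (p : C) (n : nat) : (Cmod p < 1)%R -> 1 + p ^ n <> 0.
Proof.
intros Hp; destruct n as [|n].
- simpl; intros E; apply (f_equal Re) in E; simpl in E; lra.
- replace (1 + p ^ S n) with (1 - - p * p ^ n) by (rewrite Cpow_S; ring).
  apply one_sub_pow_neq_0; rewrite ?Cmod_opp; lra.
Qed.

(** Both sides are [qpoch (- (1)) p (S n)], with the last or the first factor split off. *)
Lemma qpoch_opp_1 (p : C) (n : nat) :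
  qpoch (- (1)) p n * (1 + p ^ n) = 2 * qpoch (- p) p n.
Proof.
replace (qpoch (- (1)) p n * (1 + p ^ n)) with (qpoch (- (1)) p (S n))
  by (cbn [qpoch]; ring).
rewrite qpoch_S_l; replace (- (1) * p) with (- p) by ring; ring.
Qed.

(** * Coefficients of the two series *)

Section Coefficients.
Variable q : C.
Hypothesis Hq0 : q <> 0.
Hypothesis Hq : (Cmod q < 1)%R.

Definition lhs_coef (n : nat) : C :=
  (qpoch q (q ^ 2) n * (- q) ^ n) / (qpoch (- q) (q ^ 2) n * (1 + q ^ (2 * n))).

Lemma Cmod_sqr_lt_1 : (Cmod (q ^ 2) < 1)%R.
Proof. rewrite Cmod_pow; generalize (Cmod_ge_0 q); simpl; nra. Qed.

(** The sum is (-q;q)_(2n) / (q;q)_(2n). Splitting both symbols by parity, the parts (-q;q^2)_n and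
    (q;q^2)_n cancel against the coefficient, and [qpoch_opp_1] in base [q ^ 2] absorbs 1 +
    q^(2n). *)
Lemma coef_mul_alternating_sum (n : nat) :
  lhs_coef n * sum_n (qbinom_term (- (1)) q q) (2 * n)
  = 1 / 2 * qbinom_term (- (1)) (q ^ 2) (- q) n.
Proof.
assert (H2 := Cmod_sqr_lt_1).
rewrite sum_qbinom_term by exact Hq; unfold lhs_coef, qbinom_term.
replace (- (1) * q) with (- q) by ring.
rewrite !qpoch_double.
replace (- q * q) with (- q ^ 2) by ring.
replace (q * q) with (q ^ 2) by ring.
assert (E := qpoch_opp_1 (q ^ 2) n); rewrite <- Cpow_mult_r in E.
replace (qpoch (- q ^ 2) (q ^ 2) n)
  with (/ 2 * (qpoch (- (1)) (q ^ 2) n * (1 + q ^ (2 * n)))) by (rewrite E; field).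
field; repeat split; try (apply qpoch_neq_0; rewrite ?Cmod_opp; lra).
now apply one_add_pow_neq_0.
Qed.

(** Every factor except [(- q) ^ n] converges: the Pochhammer symbols to infinite products, nonzero
    in the denominator, and the inner sums to a q-binomial series. The terms are thus a bounded
    sequence times a geometric one. *)
Lemma ex_series_coef_mul_sum :
  ex_series (fun n => lhs_coef n * sum_n (qbinom_term (- (1)) q (- q)) (2 * n)).
Proof.
assert (H2 := Cmod_sqr_lt_1).
assert (Hmq : (Cmod (- q) < 1)%R) by now rewrite Cmod_opp.
destruct (qpoch_lim _ H2 q Hq) as [L1 _], (qpoch_lim _ H2 (- q) Hmq) as [L2 N2].
assert (L3 : Clim (fun n => 1 + q ^ (2 * n)) (1 + 0)).
{ apply Clim_plus; [apply Clim_const | now apply (Clim_even_subseq (fun n => q ^ n)), Clim_pow]. }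
assert (L4 := Clim_even_subseq _ _
  (proj2 (Clim_filterlim _ _) (qbinom_sum_correct q Hq (- (1)) (- q) Hmq))).
apply Clim_inv in L2; [|intros n; apply qpoch_neq_0; lra|exact N2].
apply Clim_inv in L3; [|intros n; now apply one_add_pow_neq_0|rewrite Cplus_0_r; apply C1_nz].
destruct (ex_series_bounded_mul_pow _ _ (- q)
  (Clim_mult _ _ _ _ (Clim_mult _ _ _ _ L1 L2) (Clim_mult _ _ _ _ L3 L4)) Hmq) as [l Hl].
exists l; revert Hl; apply is_series_ext; intros n; unfold lhs_coef.
enough (H : forall s : C,
  qpoch q (q ^ 2) n * / qpoch (- q) (q ^ 2) n * (/ (1 + q ^ (2 * n)) * s) * (- q) ^ n
  = (qpoch q (q ^ 2) n * (- q) ^ n) / (qpoch (- q) (q ^ 2) n * (1 + q ^ (2 * n))) * s)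
  by exact (H _).
intros s; field; split; [now apply one_add_pow_neq_0 | apply qpoch_neq_0; lra].
Qed.

(** Splitting off first factors in [lhs_coef (S n)] gives (1 - q) / (1 + q), and the extra power
    gives -q; the constant is the inverse of their product. *)
Lemma coef_S (n : nat) :
  (qpoch (q ^ 3) (q ^ 2) n * (- q) ^ n)
    / (qpoch (- q ^ 3) (q ^ 2) n * (1 + q ^ (2 * n + 2)))
  = - ((1 + q) / (q * (1 - q))) * lhs_coef (S n).
Proof.
assert (H2 := Cmod_sqr_lt_1).
assert (H3 : (Cmod (q ^ 3) < 1)%R)
  by (revert H2; rewrite !Cmod_pow; generalize (Cmod_ge_0 q); simpl; nra).
unfold lhs_coef; rewrite !qpoch_S_l, (Cpow_S (- q)).
replace (q * q ^ 2) with (q ^ 3) by ring.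
replace (- q * q ^ 2) with (- q ^ 3) by ring.
replace (2 * S n)%nat with (2 * n + 2)%nat by lia.
field; repeat split; auto using one_sub_neq_0, one_add_pow_neq_0.
- apply qpoch_neq_0; rewrite ?Cmod_opp; lra.
- apply one_sub_neq_0; rewrite Cmod_opp; lra.
Qed.

(** First factors again: 2 from (-1;q)_(2j+1), 1 - q from (q;q)_(2j+1), and -q from the odd
    power. *)
Lemma odd_qbinom_term (j : nat) :
  (qpoch (- q) q (2 * j) * q ^ (2 * j)) / qpoch (q ^ 2) q (2 * j)
  = - ((1 - q) / (2 * q)) * qbinom_term (- (1)) q (- q) (2 * j + 1).
Proof.
assert (H2 := Cmod_sqr_lt_1).
unfold qbinom_term; rewrite Nat.add_1_r, !qpoch_S_l.
replace (- (1) * q) with (- q) by ring.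
replace (q * q) with (q ^ 2) by ring.
rewrite (Cpow_S (- q)), (Cpow_mult_r (- q)).
replace ((- q) ^ 2) with (q ^ 2) by ring; rewrite <- Cpow_mult_r.
field; repeat split; auto using one_sub_neq_0.
apply qpoch_neq_0; lra.
Qed.

End Coefficients.

Theorem theorem1p3 (q : C) (hq0 : (0 < Cmod q)%R) (hq1 : (Cmod q < 1)%R) :
  let lhs_term := fun n : nat =>
    (qpoch q (q ^ 2) n * (- q) ^ n)
      / (qpoch (- q) (q ^ 2) n * (1 + q ^ (2 * n)))
    * little_q_jacobi (2 * n) (- (1)) (/ q ^ (2 * n + 1)) (- (1)) q in
  let rhs_term := fun n : nat =>
    (qpoch (q ^ 3) (q ^ 2) n * (- q) ^ n)
      / (qpoch (- q ^ 3) (q ^ 2) n * (1 + q ^ (2 * n + 2)))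
    * sum_n (fun j : nat =>
        (qpoch (- q) q (2 * j) * q ^ (2 * j)) / qpoch (q ^ 2) q (2 * j)) n in
  ex_series lhs_term /\ ex_series rhs_term /\
  CSeries lhs_term
  = 1 / 2 * (qpoch_inf q (q ^ 2) / qpoch_inf (- q) (q ^ 2))
    + (4 * q ^ 2) / (1 + q) * CSeries rhs_term.
Proof.
intros lhs_term rhs_term.
assert (Hq0 : q <> 0) by now apply Cmod_gt_0.
assert (H2 := Cmod_sqr_lt_1 q hq1).
assert (Hmq : (Cmod (- q) < 1)%R) by now rewrite Cmod_opp.
assert (H1q : 1 + q <> 0) by (rewrite <- (Cpow_1_r q); now apply one_add_pow_neq_0).
assert (H1mq : 1 - q <> 0) by now apply one_sub_neq_0.
set (d := fun n => 1 / 2 * qbinom_term (- (1)) (q ^ 2) (- q) n).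
set (D := 1 / 2 * (qpoch_inf q (q ^ 2) / qpoch_inf (- q) (q ^ 2))).
assert (HD : is_series d D).
{ refine (is_series_scal (1 / 2) _ _ _).
  (* The numerator product is put in the form (az; q^2)_oo with [a = - 1] and [z = - q]. *)
  replace q with (- (1) * - q) at 3 by ring.
  apply q_binomial; [exact H2 | exact Hmq |].
  now replace (- (1) * - q) with q by ring. }
destruct (ex_series_coef_mul_sum q hq1) as [L HL0].
change C in L.
assert (HL : is_series lhs_term L).
{ revert HL0; apply is_series_ext; intros n; unfold lhs_term.
  now rewrite little_q_jacobi_as_qbinom. }
(* The difference on the left is twice the coefficient times the odd-indexed sum; the constants of
   [coef_S] and [odd_qbinom_term] multiply to (1 + q) / (2 q^2), which that 2 halves. *)
assert (E : forall n, (1 + q) / (4 * q ^ 2) * (lhs_term (S n) - d (S n)) = rhs_term n).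
{ intros n; unfold lhs_term, rhs_term, d.
  rewrite little_q_jacobi_as_qbinom by easy.
  rewrite <- coef_mul_alternating_sum by easy.
  rewrite coef_S by easy.
  rewrite (sum_n_ext _ _ n (odd_qbinom_term q Hq0 hq1)).
  rewrite sum_n_even_odd.
  rewrite (sum_n_ext (fun j => (- (1)) ^ j * qbinom_term (- (1)) q (- q) j)
             (qbinom_term (- (1)) q q) (2 * S n)).
  2: { intros j; unfold qbinom_term.
       match goal with |- ?x = ?y => change (@eq C x y) end.
       replace (q ^ j) with ((- (1)) ^ j * (- q) ^ j); [ring|].
       rewrite <- Cpow_mult_l; f_equal; ring. }
  rewrite (sum_n_mult_l (K := C_Ring)).
  enough (H : forall c O B : C,
    (1 + q) / (4 * q ^ 2) * (c * (2 * O + B) - c * B)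
    = - ((1 + q) / (q * (1 - q))) * c * (- ((1 - q) / (2 * q)) * O))
    by exact (H (lhs_coef q (S n)) _ _).
  intros c O B; field; auto. }
assert (HR : is_series rhs_term ((1 + q) / (4 * q ^ 2) * (L - D))).
{ apply (is_series_ext _ _ _ E).
  refine (is_series_scal _ _ _ _).
  apply (is_series_incr_1 (fun n => lhs_term n - d n)).
  refine (eq_ind _ (is_series _) (is_series_minus _ _ _ _ HL HD) _ _).
  change (L - D = L - D + (lhs_term 0%nat - d 0%nat)).
  (* At [n = 0] the plain and the alternating sum consist of the same single term, so the shift by
     one loses nothing. *)
  replace (lhs_term 0%nat) with (d 0%nat); [ring|].
  unfold d; rewrite <- coef_mul_alternating_sum by easy.
  unfold lhs_term; rewrite little_q_jacobi_as_qbinom by easy.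
  change (2 * 0)%nat with 0%nat; rewrite !sum_O; reflexivity. }
split; [now exists L|]; split; [now exists ((1 + q) / (4 * q ^ 2) * (L - D))|].
rewrite (CSeries_unique _ _ HL), (CSeries_unique _ _ HR).
field; auto.
Qed.
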